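(* Let $i\in\{2,3\}$ and let $(X,e)$ be a co-algebra for $F_i$ on $\mathbf{Set}_i$. Then the mediating morphism $f:X\to S_i$, i.e. the unique morphism of $\mathbf{Set}_i$ with $\psi_i\circ f=(M_i\otimes f)\circ e$, is given by $$f(x)=\lim_{k\to\infty}\theta_k ,$$ where $(\theta_k)$ is a sequence in $G_i\subseteq S_i$ associated with $x$ as in the context, and the limit is taken in $S_i$.
   Context: **Pointed sets and metric spaces.** A bi-pointed set is $(X,\top,\bot)$, a set with two distinguished elements; a tri-pointed set is $(X,T,L,R)$, a set with three distinguished elements. $\mathbf{Set}_i$ ($i=2,3$) is the category of $i$-pointed sets and functions preserving the distinguished elements. An $i$-pointed metric space is an $i$-pointed set with a metric $d\le 1$ such that distinct distinguished elements are at distance $1$. **The functors.** $M_2=\{l,r\}$, $M_3=\{a,b,c\}$. $M_2\otimes X$ is the quotient of $M_2\times X$ by the equivalence relation generated by $(l,\top)\sim(r,\bot)$, with $\bot_{M_2\otimes X}=l\otimes\bot$, $\top_{M_2\otimes X}=r\otimes\top$. $M_3\otimes X$ is the quotient of $M_3\times X$ by the equivalence relation generated by $(b,T)\sim(a,L)$, $(a,R)\sim(c,T)$, $(c,L)\sim(b,R)$, with distinguished elements $T=a\otimes T$, $L=b\otimes L$, $R=c\otimes R$. Here $m\otimes x$ is the class of $(m,x)$. Put $F_iX=M_i\otimes X$ and $F_if=M_i\otimes f$, $(M_i\otimes f)(m\otimes x)=m\otimes f(x)$. If $X$ is an $i$-pointed metric space, $M_i\times X$ has the metric equal to $\frac12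 d(x,y)$ between $(m,x),(m,y)$ and $1$ between $(m,x),(n,y)$ with $m\ne n$, and $M_i\otimes X$ carries the quotient metric. Explicitly $d(m\otimes x,m\otimes y)=\frac12 d(x,y)$; for $i=2$, $d(l\otimes x,r\otimes y)=\frac12(d(x,\top)+d(\bot,y))$; for $i=3$, $d(a\otimes x,b\otimes y)=\frac12\min\{d(x,L)+d(T,y),\,d(x,R)+1+d(R,y)\}$, $d(a\otimes x,c\otimes y)=\frac12\min\{d(x,R)+d(T,y),\,d(x,L)+1+d(L,y)\}$, $d(b\otimes x,c\otimes y)=\frac12\min\{d(x,R)+d(L,y),\,d(x,T)+1+d(T,y)\}$. A co-algebra for $F_i$ on $\mathbf{Set}_i$ is an $i$-pointed set $X$ with a morphism $e:X\to M_i\otimes X$ of $\mathbf{Set}_i$. **The co-algebra $(S_i,\psi_i)$.** Let $I$ be the set of $i$ distinguished points, at mutual distance $1$, and $!:I\to M_i\otimes I$ the unique map preserving distinguished elements. $G_i$ is the colimit of the chain of isometric embeddings $I\to M_i\otimes I\to M_i^2\otimes I\to\cdots$ with maps $M_i^n\otimes !$, where $M_i^{n+1}\otimes I=M_i\otimes(M_i^n\otimes I)$; its elements are classes $[m_1\otimes\cdots\otimes m_k\otimes d]$ with $m_j\in M_i$, $d\in I$. The map $g_i:M_i\otimes G_i\to G_i$, $g_i(m\otimes[x])=[m\otimes x]$, is an isometric bijection. $S_i$ is the Cauchy completion of $G_i$, and $\psi_i:S_i\to M_i\otimes S_i$ is the continuous extension of $g_i^{-1}$, so $\psi_i([m_1\otimes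 m_2\otimes\cdots\otimes m_k\otimes d])=m_1\otimes[m_2\otimes\cdots\otimes m_k\otimes d]$. It is known that, after forgetting the metric, $(S_i,\psi_i)$ is the final co-algebra of $F_i$ on $\mathbf{Set}_i$. **The sequence $(\theta_n)$.** Given $x\in X$, iterate $e$: put $x_0=x$ and choose inductively $m_n\in M_i$, $x_n\in X$ with $e(x_{n-1})=m_n\otimes x_n$; thus $\chi_n=m_1\otimes\cdots\otimes m_n\otimes x_n\in M_i^n\otimes X$ is the image of $x$ under $(M_i^{n-1}\otimes e)\circ\cdots\circ(M_i\otimes e)\circ e$. Put $\theta_n=[m_1\otimes\cdots\otimes m_n\otimes\overline{x_n}]\in G_i$, where for $i=3$, $\overline{x_n}\in\{T,L,R\}$ is $T$, $L$, $R$ according as $m_n$ is $a$, $b$, $c$; for $i=2$, $\overline{x_n}$ is $\bot$, $\top$ according as $m_n$ is $l$, $r$. The sequence $(\theta_n)$ is Cauchy in $G_i$, and its limit in $S_i$ does not depend on the choices made. *)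

(* Defs.v *)
From HB Require Import structures.
From Stdlib Require Import Relation_Operators.
From mathcomp Require Import all_boot all_order all_algebra generic_quotient.
From mathcomp Require Import all_classical all_reals all_analysis.
From mathcomp Require Import ring lra.

Set Implicit Arguments.
Unset Strict Implicit.
Unset Printing Implicit Defensive.

Import Order.TTheory GRing.Theory Num.Theory.
Import numFieldNormedType.Exports.

Local Open Scope classical_set_scope.
Local Open Scope ring_scope.
Local Open Scope quotient_scope.

Section GeneratedQuotient.
Variables (T : choiceType) (r : T -> T -> Prop).

Definition gen_equiv : rel T := fun x y => `[< clos_refl_sym_trans T r x y >].

Lemma gen_equiv_class : equiv_class_of gen_equiv.
Proof.
split.
- by move=> x; apply/asboolP; apply: rst_refl.
- by move=> x y; apply/asboolP/asboolP => h; apply: rst_sym.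
- by move=> y x z /asboolP h1 /asboolP h2; apply/asboolP; apply: rst_trans h1 h2.
Qed.

Canonical gen_equiv_rel := EquivRelPack gen_equiv_class.

Definition gen_quot : Type := {eq_quot gen_equiv_rel}.
HB.instance Definition _ := Choice.on gen_quot.

Definition cls (x : T) : gen_quot := \pi_({eq_quot gen_equiv_rel}) x.

Definition rep (q : gen_quot) : T := repr (q : {eq_quot gen_equiv_rel}).

Lemma repK : cancel rep cls. Proof. exact: reprK. Qed.

Lemma clsP x y : cls x = cls y <-> clos_refl_sym_trans T r x y.
Proof.
split=> [/(@eqquotP _ gen_equiv_rel) /asboolP //|h].
by apply/(@eqquotP _ gen_equiv_rel)/asboolP.
Qed.

Variables (R : realType) (d : T -> T -> R).

(* [chain x y c]: a finite chain from [x] to [y] of total cost [c]; a step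
   inside [T] costs its length and moving within a class is free. *)
Inductive chain : gen_quot -> gen_quot -> R -> Prop :=
| chain_nil x : chain x x 0
| chain_step p q y c : chain (cls q) y c -> chain (cls p) y (d p q + c).

Definition quot_dist (x y : gen_quot) : R := inf [set c | chain x y c].

End GeneratedQuotient.

Inductive kind := Bi | Tri.

(* [D2], [D3]: names of the distinguished elements. *)
Inductive D2 := Top | Bot.
Inductive D3 := DT | DL | DR.
Inductive M2 := Ml | Mr.
Inductive M3 := Ma | Mb | Mc.

HB.instance Definition _ := gen_eqMixin D2.
HB.instance Definition _ := gen_choiceMixin D2.
HB.instance Definition _ := gen_eqMixin D3.
HB.instance Definition _ := gen_choiceMixin D3.
HB.instance Definition _ := gen_eqMixin M2.
HB.instance Definition _ := gen_choiceMixin M2.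
HB.instance Definition _ := gen_eqMixin M3.
HB.instance Definition _ := gen_choiceMixin M3.

Definition Di (i : kind) : choiceType := if i is Bi then D2 else D3.
Definition Mi (i : kind) : choiceType := if i is Bi then M2 else M3.

(* Distinguished elements are required to be pairwise distinct: without this
   the one-point co-algebra would admit no morphism to the final one. *)
HB.mixin Record hasDistinguished (i : kind) (X : Type) := {
  dpt : Di i -> X;
  dpt_inj : injective dpt
}.

#[short(type="iptType")]
HB.structure Definition IPointed (i : kind) :=
  {X of Choice X & hasDistinguished i X}.

HB.mixin Record isIPMetric (R : realType) (i : kind) (X : Type)
    of Metric R X & IPointed i X := {
  mdist_le1 : forall x y : X, (mdist x y : R) <= 1;
  mdist_dpt : forall d e : Di i, d <> e ->
    mdist (dpt d : X) (dpt e : X) = 1 :> R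
}.

#[short(type="ipmetType")]
HB.structure Definition IPMetric (R : realType) (i : kind) :=
  {X of Metric R X & IPointed i X & isIPMetric R i X}.

Record ipt_hom (i : kind) (X Y : iptType i) := IptHom {
  hfun :> X -> Y;
  hom_dpt : forall d : Di i, hfun (dpt d) = dpt d
}.

Inductive glue2 (X : iptType Bi) : M2 * X -> M2 * X -> Prop :=
| glue_lr : glue2 (Ml, dpt (Top : Di Bi)) (Mr, dpt (Bot : Di Bi)).

Inductive glue3 (X : iptType Tri) : M3 * X -> M3 * X -> Prop :=
| glue_ba : glue3 (Mb, dpt (DT : Di Tri)) (Ma, dpt (DL : Di Tri))
| glue_ac : glue3 (Ma, dpt (DR : Di Tri)) (Mc, dpt (DT : Di Tri))
| glue_cb : glue3 (Mc, dpt (DL : Di Tri)) (Mb, dpt (DR : Di Tri)).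

Definition glue (i : kind) : forall X : iptType i, Mi i * X -> Mi i * X -> Prop :=
  match i with Bi => glue2 | Tri => glue3 end.

Definition tens (i : kind) (X : iptType i) : Type := gen_quot (@glue i X).
HB.instance Definition _ i (X : iptType i) := Choice.on (tens X).

Definition tensor (i : kind) (X : iptType i) (m : Mi i) (x : X) : tens X :=
  cls (@glue i X) (m, x).

Notation "m ⊗ x" := (tensor m x) (at level 40, left associativity).

(* The distinguished element named [d] of [tens X] is [own d ⊗ dpt d]; the
   inverse [bar] of [own] is the rule giving the last entry of [theta]. *)
Definition own (i : kind) : Di i -> Mi i :=
  match i return Di i -> Mi i with
  | Bi => fun d => match d with Bot => Ml | Top => Mr end
  | Tri => fun d => match d with DT => Ma | DL => Mb | DR => Mc end
  end.

Definition bar (i : kind) : Mi i -> Di i :=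
  match i return Mi i -> Di i with
  | Bi => fun m => match m with Ml => Bot | Mr => Top end
  | Tri => fun m => match m with Ma => DT | Mb => DL | Mc => DR end
  end.

Lemma ownK i : cancel (@own i) (@bar i).
Proof. by case: i => -[]. Qed.

Lemma barK i : cancel (@bar i) (@own i).
Proof. by case: i => -[]. Qed.

Section TensPoints.
Variables (i : kind) (X : iptType i).

Lemma glue_nocorner (d : Di i) (p q : Mi i * X) : glue p q ->
  p <> (own d, dpt d) /\ q <> (own d, dpt d).
Proof.
case: i X d p q => Y d p q [];
  by split; case: d => // -[] /dpt_inj.
Qed.

Lemma tensor_dpt_inj : injective (fun d : Di i => own d ⊗ (dpt d : X)).
Proof.
move=> d e /clsP h.
suff : (own d, dpt d) = (own e, dpt e) :> Mi i * X by case=> _ /dpt_inj.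
have H p q : clos_refl_sym_trans _ (@glue i X) p q ->
    (p = (own d, dpt d) <-> q = (own d, dpt d)).
  elim=> [x y g|x|x y _ [h1 h2]|x y z _ [h1 h2] _ [h3 h4]]; try by split; auto.
  by have [n1 n2] := glue_nocorner d g; split=> /[dup] ? //.
by rewrite (proj1 (H _ _ h)).
Qed.

HB.instance Definition _ :=
  hasDistinguished.Build i (tens X) tensor_dpt_inj.

Lemma tens_dptE (d : Di i) : dpt d = own d ⊗ dpt d :> tens X.
Proof. by []. Qed.

Lemma tensP (xi : tens X) : exists m x, xi = m ⊗ x.
Proof. by rewrite -(repK xi); case: (rep xi) => m x; exists m, x. Qed.

End TensPoints.

Section TensMap.
Variables (i : kind) (X Y : iptType i) (f : ipt_hom X Y).

Definition tmap_fun (xi : tens X) : tens Y := (rep xi).1 ⊗ f (rep xi).2.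

Lemma glue_map (p q : Mi i * X) : glue p q ->
  glue (p.1, f p.2) (q.1, f q.2).
Proof.
by case: i X Y f p q => X' Y' f' p q [] /=; rewrite !hom_dpt; constructor.
Qed.

Lemma tmap_funE m x : tmap_fun (m ⊗ x) = m ⊗ f x.
Proof.
rewrite /tmap_fun; set p := rep _.
have /clsP : cls (@glue i X) p = cls (@glue i X) (m, x) by rewrite repK.
rewrite -[RHS]/(((m, x) : Mi i * X).1 ⊗ f ((m, x) : Mi i * X).2).
elim=> [x1 y g|//|x1 y _ ->//|x1 y z _ -> _ ->//].
by apply/clsP/rst_step/glue_map.
Qed.

Lemma tmap_dpt d : tmap_fun (dpt d) = dpt d.
Proof. by rewrite tens_dptE tmap_funE hom_dpt. Qed.

Definition tmap : ipt_hom (tens X) (tens Y) := IptHom tmap_dpt.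

Lemma tmapE m x : tmap (m ⊗ x) = m ⊗ f x.
Proof. exact: tmap_funE. Qed.

End TensMap.
Definition prod_dist (R : realType) (i : kind) (X : ipmetType R i)
    (p q : Mi i * X) : R :=
  if p.1 == q.1 then mdist p.2 q.2 / 2 else 1.

Definition tens_dist (R : realType) (i : kind) (X : ipmetType R i) :
    tens X -> tens X -> R :=
  @quot_dist _ (@glue i X) R (@prod_dist R i X).

Lemma M2E (m n : Mi Bi) :
  (m == n) = match m, n with Ml, Ml | Mr, Mr => true | _, _ => false end.
Proof. by case: m n => -[]; apply/eqP. Qed.

Lemma M3E (m n : Mi Tri) : (m == n) =
  match m, n with Ma, Ma | Mb, Mb | Mc, Mc => true | _, _ => false end.
Proof. by case: m n => -[]; apply/eqP. Qed.

(* [phi m n] names the point of the copy [m] that is glued to the copy [n],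
   and [third m n] is the remaining copy. *)
Definition phi (i : kind) : Mi i -> Mi i -> Di i :=
  match i return Mi i -> Mi i -> Di i with
  | Bi => fun m _ => match m with Ml => Top | Mr => Bot end
  | Tri => fun m n => match m, n with
      | Ma, Mb => DL | Ma, _ => DR
      | Mb, Ma => DT | Mb, _ => DR
      | Mc, Ma => DT | Mc, _ => DL end
  end.

Definition third (m n : M3) : M3 :=
  match m, n with
  | Ma, Mb => Mc | Mb, Ma => Mc | Ma, _ => Mb | _, Ma => Mb | _, _ => Ma
  end.

(* [rho2] and [rho3] are the explicit formulas for the quotient metric, see
   [tens_mdistE]. *)
Section ExplicitDist.
Variable R : realType.

Definition rho2 (X : ipmetType R Bi) (p q : Mi Bi * X) : R :=
  if p.1 == q.1 then mdist p.2 q.2 / 2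
  else (mdist p.2 (dpt (phi p.1 q.1)) + mdist q.2 (dpt (phi q.1 p.1))) / 2.

Definition rho3 (X : ipmetType R Tri) (p q : Mi Tri * X) : R :=
  let k := third p.1 q.1 in
  if p.1 == q.1 then mdist p.2 q.2 / 2
  else Num.min
    (mdist p.2 (dpt (phi p.1 q.1 : Di Tri)) + mdist q.2 (dpt (phi q.1 p.1 : Di Tri)))
    (mdist p.2 (dpt (phi p.1 k : Di Tri)) + 1 + mdist q.2 (dpt (phi q.1 k : Di Tri))) / 2.

Definition rho (i : kind) : forall X : ipmetType R i, Mi i * X -> Mi i * X -> R :=
  match i with Bi => rho2 | Tri => rho3 end.

Lemma minP (a b : R) : (Num.min a b <= a) /\ (Num.min a b <= b) /\
  (Num.min a b = a \/ Num.min a b = b).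
Proof.
by rewrite /Num.min; case: ltP => h; split=> //; [split; [exact: ltW|left]|split=> //; right].
Qed.

Lemma dpt_dist i (X : ipmetType R i) (d e : Di i) :
  mdist (dpt d : X) (dpt e) = (d != e)%:R.
Proof.
by have [->|/eqP/mdist_dpt ->//] := eqVneq d e; rewrite mdistxx.
Qed.

Lemma rho_xx i (X : ipmetType R i) p : @rho i X p p = 0.
Proof. by case: i X p => X p; rewrite /= /rho2 /rho3 eqxx mdistxx mul0r. Qed.

Lemma rho_sym i (X : ipmetType R i) p q : @rho i X p q = rho q p.
Proof.
case: i X p q => X p q /=.
  by rewrite /rho2 eq_sym metric_sym [in X in _ = if _ then _ else X]addrC.
case: p q => [m x] [n y]; rewrite /rho3 eq_sym metric_sym /=; case: ifP => // _.
have -> : third n m = third m n by case: m n => -[].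
by congr (Num.min _ _ / _); ring.
Qed.

Lemma rho_ge0 i (X : ipmetType R i) p q : 0 <= @rho i X p q.
Proof.
case: i X p q => X p q; rewrite /= /rho2 /rho3; case: ifP => _;
  rewrite divr_ge0 ?addr_ge0 ?mdist_ge0//.
by rewrite le_min !addr_ge0 ?mdist_ge0.
Qed.

Lemma pt_dist (T : metricType R) (p x y : T) :
  [/\ mdist x y <= mdist x p + mdist y p :> R,
      mdist x p <= mdist x y + mdist y p :> R
    & mdist y p <= mdist x y + mdist x p :> R].
Proof.
split; first by rewrite (metric_sym y) metric_triangle.
  exact: metric_triangle.
by rewrite (metric_sym x y) metric_triangle.
Qed.

Lemma pts_dist (T : metricType R) (p q x : T) : mdist p q = 1 :> R ->
  1 <= mdist x p + mdist x q :> R.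
Proof. by move=> <-; rewrite (metric_sym x p) metric_triangle. Qed.

Lemma rho2_triangle (X : ipmetType R Bi) (q p r : Mi Bi * X) :
  rho2 p r <= rho2 p q + rho2 q r.
Proof.
case: p q r => [m x] [n y] [k z]; rewrite /rho2 /= !M2E.
pose t : X := dpt (Top : Di Bi); pose b : X := dpt (Bot : Di Bi).
have tb : mdist t b = 1 :> R by exact: mdist_dpt.
have [xt1 xt2 xt3] := pt_dist t x y; have [xb1 xb2 xb3] := pt_dist b x y.
have [yt1 yt2 yt3] := pt_dist t y z; have [yb1 yb2 yb3] := pt_dist b y z.
have [zt1 zt2 zt3] := pt_dist t x z; have [zb1 zb2 zb3] := pt_dist b x z.
have x1 := pts_dist x tb; have y1 := pts_dist y tb; have z1 := pts_dist z tb.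
have := metric_triangle x y z.
have := (mdist_le1 x z : _ <= 1 :> R).
have := (mdist_ge0 x t : 0 <= _ :> R); have := (mdist_ge0 x b : 0 <= _ :> R).
have := (mdist_ge0 y t : 0 <= _ :> R); have := (mdist_ge0 y b : 0 <= _ :> R).
have := (mdist_ge0 z t : 0 <= _ :> R); have := (mdist_ge0 z b : 0 <= _ :> R).
subst t b; by case: m n k => -[] [] /=; lra.
Qed.

Lemma third_sym m n : third m n = third n m.
Proof. by case: m n => -[]. Qed.

Lemma rho3_triangle (X : ipmetType R Tri) (q p r : Mi Tri * X) :
  rho3 p r <= rho3 p q + rho3 q r.
Proof.
case: p q r => [m x] [n y] [k z]; rewrite /rho3 /=.
have g0 (u v : X) := (mdist_ge0 u v : 0 <= _ :> R).
have l1 (u v : X) := (mdist_le1 u v : _ <= 1 :> R).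
have [->{m}|mn] := eqVneq m n; have [E|nk] := eqVneq n k; rewrite ?eqxx.
- have := metric_triangle x y z; lra.
- rewrite ?(negbTE nk); set p1 : X := dpt (phi n k : Di Tri).
  set p2 : X := dpt (phi n _ : Di Tri).
  have [_ f1 _] := pt_dist p1 x y; have [_ f2 _] := pt_dist p2 x y.
  set u := mdist z _; set v := mdist z _.
  have [h1 [h2 _]] := minP (mdist x p1 + u) (mdist x p2 + 1 + v).
  have [_ [_ [->|->]]] := minP (mdist y p1 + u) (mdist y p2 + 1 + v); lra.
- rewrite -?E ?(negbTE mn); set p1 : X := dpt (phi n m : Di Tri).
  set p2 : X := dpt (phi n _ : Di Tri).
  have [_ _ f1] := pt_dist p1 y z; have [_ _ f2] := pt_dist p2 y z.
  set u := mdist x _; set v := mdist x _.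
  have [h1 [h2 _]] := minP (u + mdist z p1) (v + 1 + mdist z p2).
  have [_ [_ [->|->]]] := minP (u + mdist y p1) (v + 1 + mdist y p2); lra.
have [<-{k nk}|mk] := eqVneq m k.
  rewrite ?eqxx ?(eq_sym n) ?(negbTE mn) (third_sym n m); set p1 : X := dpt (phi m n : Di Tri).
  set p2 : X := dpt (phi n m : Di Tri).
  set p3 : X := dpt (phi m _ : Di Tri); set p4 : X := dpt (phi n _ : Di Tri).
  have [f1 _ _] := pt_dist p1 x z; have f2 := l1 x z.
  have := (g0 y p2, g0 y p4, g0 x p1, g0 z p1, g0 x p3, g0 z p3).
  move=> [[[[[? ?] ?] ?] ?] ?].
  have [_ [_ [->|->]]] := minP (mdist x p1 + mdist y p2) (mdist x p3 + 1 + mdist y p4);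
  have [_ [_ [->|->]]] := minP (mdist y p2 + mdist z p1) (mdist y p4 + 1 + mdist z p3); lra.
have yP (d e : Di Tri) : d <> e -> 1 <= mdist y (dpt d) + mdist y (dpt e) :> R.
  by move=> de; apply: pts_dist; exact: mdist_dpt.
have f1 := yP DT DL ltac:(by []); have f2 := yP DT DR ltac:(by []).
have f3 := yP DL DR ltac:(by []) => {yP}.
have Gi u := (g0 u (dpt (DT : Di Tri)), g0 u (dpt (DL : Di Tri)),
             g0 u (dpt (DR : Di Tri))).
have [[? ?] ?] := Gi x; have [[? ?] ?] := Gi y; have [[? ?] ?] := Gi z.
have L u := (l1 u (dpt (DT : Di Tri)), l1 u (dpt (DL : Di Tri)),
             l1 u (dpt (DR : Di Tri))).
have [[? ?] ?] := L x; have [[? ?] ?] := L z.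
move: mn nk mk {g0 l1 Gi L}; rewrite !M3E.
by case: m n k => -[] [] // _ _ _ /=;
  match goal with |- is_true (Num.min ?a ?b / 2 <=
       Num.min ?c ?d / 2 + Num.min ?e ?f / 2) =>
    have [? [? _]] := minP a b;
    have [_ [_ [->|->]]] := minP c d; have [_ [_ [->|->]]] := minP e f; lra
  end.
Qed.

End ExplicitDist.
Section TensMetric.
Variables (R : realType) (i : kind) (X : ipmetType R i).
Implicit Types (p q r : Mi i * X) (x y : X) (m n : Mi i).

Let C : Mi i * X -> tens X := cls (@glue i X).
Let ch : tens X -> tens X -> R -> Prop := @chain _ (@glue i X) R (@prod_dist R i X).

Lemma rho_triangle q p r : rho p r <= rho p q + rho q r :> R.
Proof.
by move: X q p r; case: (i) => Y q p r; [exact: rho2_triangle|exact: rho3_triangle].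
Qed.

Lemma rho_diag m x y : rho (m, x) (m, y) = mdist x y / 2 :> R.
Proof. by move: X m x y; case: (i) => Y m x y; rewrite /= /rho2 /rho3 /= eqxx. Qed.

Lemma rho_le_prod p q : rho p q <= prod_dist p q :> R.
Proof.
have l1 (Z : metricType R) (u v : Z) : mdist u v <= 1 :> R -> mdist u v / 2 <= 2^-1 :> R by lra.
rewrite /prod_dist; move: X p q; case: (i) => Y p q; rewrite /= /rho2 /rho3;
  case: ifP => // _.
  have := (mdist_le1 p.2 (dpt (phi p.1 q.1)) : _ <= 1 :> R).
  have := (mdist_le1 q.2 (dpt (phi q.1 p.1)) : _ <= 1 :> R); lra.
have := (mdist_le1 p.2 (dpt (phi p.1 q.1 : Di Tri)) : _ <= 1 :> R).
have := (mdist_le1 q.2 (dpt (phi q.1 p.1 : Di Tri)) : _ <= 1 :> R).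
set a := mdist p.2 _; set b := mdist q.2 _; set c := _ + _ + _.
by have [h _] := minP (a + b) c; lra.
Qed.

Lemma rho_le1 p q : rho p q <= 1 :> R.
Proof.
apply: le_trans (rho_le_prod p q) _; rewrite /prod_dist; case: ifP => // _.
have := (mdist_le1 p.2 q.2 : _ <= 1 :> R); lra.
Qed.

Lemma glueP p q : glue p q -> exists m n, [/\ m <> n,
  p = (m, dpt (phi m n)) & q = (n, dpt (phi n m))].
Proof.
move: X p q; case: (i) => Y p q [].
- by exists Ml, Mr.
- by exists Mb, Ma.
- by exists Ma, Mc.
- by exists Mc, Mb.
Qed.

Lemma phi_cls m n : m <> n ->
  C (m, dpt (phi m n)) = C (n, dpt (phi n m)).
Proof.
move=> mn; apply/clsP; move: X m n mn; case: (i) => Y -[] [] // _;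
  by [apply: rst_step; constructor|apply: rst_sym; apply: rst_step; constructor].
Qed.

Lemma rho_glue m n : m <> n -> rho (m, dpt (phi m n) : X) (n, dpt (phi n m)) = 0 :> R.
Proof.
move: X m n; case: (i) => Y m n /eqP mn; rewrite /= /rho2 /rho3 /= (negbTE mn) !mdistxx ?addr0 ?mul0r//.
set c := _ + _ + _; have [h1 [h2 h3]] := minP 0 c.
have : 0 <= c by rewrite !addr_ge0 ?mdist_ge0.
by case: h3 => E ?; rewrite E in h1 *; lra.
Qed.

Lemma rho_equiv p q : C p = C q -> rho p q = 0 :> R.
Proof.
move/clsP; elim=> {p q} [p q|p|p q _ <-|p q r _ h1 _ h2].
- by move=> /glueP[m [n [mn -> ->]]]; exact: rho_glue.
- exact: rho_xx.
- exact: rho_sym.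
- apply/eqP; rewrite eq_le rho_ge0 andbT.
  by rewrite (le_trans (rho_triangle q p r)) // h1 h2 addr0.
Qed.

Lemma rho_equiv_l p q r : C p = C q -> rho p r = rho q r :> R.
Proof.
move=> E; have h := rho_equiv E; have h' := h; rewrite rho_sym in h'.
by apply/eqP; rewrite eq_le; apply/andP; split;
  [rewrite -[leRHS]add0r -h|rewrite -[leRHS]add0r -h']; exact: rho_triangle.
Qed.

Lemma chain_ge p q c : ch (C p) (C q) c -> rho p q <= c :> R.
Proof.
rewrite /ch; move: (erefl (C p)) (erefl (C q)); move: {-2}(C p) {-2}(C q) => xi eta Ep Eq h.
elim: h p q Ep Eq => {xi eta c} [xi|p' q' eta c _ IH] p q Ep Eq.
  by rewrite rho_equiv // -Ep -Eq.
rewrite (rho_equiv_l q (esym Ep)) (le_trans (rho_triangle q' _ _)) // lerD ?rho_le_prod //.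
exact: IH.
Qed.

Lemma chain1 p q : ch (C p) (C q) (prod_dist p q).
Proof. by rewrite -[prod_dist p q]addr0; apply: chain_step; exact: chain_nil. Qed.

Lemma chain_cat xi eta zeta c d : ch xi eta c -> ch eta zeta d -> ch xi zeta (c + d).
Proof.
move=> h; elim: h d zeta => [x d z|p q y {}c _ IH d z /IH h]; first by rewrite add0r.
by rewrite -addrA; exact: chain_step.
Qed.

Lemma prod_diag m x y : prod_dist (m, x) (m, y) = mdist x y / 2 :> R.
Proof. by rewrite /prod_dist eqxx. Qed.

Lemma chain_route1 m n x y : m <> n ->
  ch (C (m, x)) (C (n, y)) ((mdist x (dpt (phi m n)) + mdist y (dpt (phi n m))) / 2).
Proof.
move=> mn; rewrite mulrDl (metric_sym y) -(prod_diag m) -(prod_diag n).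
by apply: chain_cat (chain1 _ _); rewrite -phi_cls //; exact: chain1.
Qed.

Lemma chain_rho p q : ch (C p) (C q) (rho p q).
Proof.
case: p q => [m x] [n y]; have [<-|/eqP mn] := eqVneq m n.
  by rewrite rho_diag -(prod_diag m); exact: chain1.
have H := chain_route1; have HC := chain_cat; move: H HC; rewrite /ch /C.
move: X m n mn x y; case: (i) => Y m n mn x y H HC.
  by rewrite /= /rho2 /=; move/eqP/negbTE: (mn) => ->; exact: H.
rewrite /= /rho3 /=; move/eqP/negbTE: (mn) => ->; set k := third m n.
have [mk nk] : m <> k /\ k <> n by rewrite {}/k; move: mn; case: (m) (n) => -[].
have [_ [_ [->|->]]] := minP
    (mdist x (dpt (phi m n : Di Tri)) + mdist y (dpt (phi n m : Di Tri)))
    (mdist x (dpt (phi m k : Di Tri)) + 1 + mdist y (dpt (phi n k : Di Tri))).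
  exact: H.
have kk : @phi Tri k m <> @phi Tri k n by rewrite {mk nk}/k; move: mn; case: (m) (n) => -[].
have := H m k x (dpt (@phi Tri k n)) mk.
rewrite (metric_sym (dpt (@phi Tri k n)) (dpt (@phi Tri k m))) mdist_dpt//.
move=> h1.
have := H k n (dpt (@phi Tri k n)) y nk; rewrite mdistxx add0r => h2.
by rewrite mulrDl; exact: HC h1 h2.
Qed.
End TensMetric.
Section TensMetricInst.
Variables (R : realType) (i : kind) (X : ipmetType R i).
Implicit Types (p q r : Mi i * X) (x y : X) (m n : Mi i).

Lemma tens_distE p q : tens_dist (cls (@glue i X) p) (cls (@glue i X) q) = rho p q.
Proof.
apply/eqP; rewrite eq_le; apply/andP; split.
  apply: ge_inf; last exact: chain_rho.
  exists (rho p q) => c; exact: chain_ge.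
apply: lb_le_inf; first by exists (rho p q); exact: chain_rho.
by move=> c; exact: chain_ge.
Qed.

Lemma rho_eq0 p q : rho p q = 0 :> R -> cls (@glue i X) p = cls (@glue i X) q.
Proof.
case: p q => [m x] [n y]; have [<-|/eqP mn] := eqVneq m n.
  rewrite rho_diag => h; suff -> : x = y by [].
  by apply: (@mdist_positivity R); lra.
have K : (mdist x (dpt (phi m n)) + mdist y (dpt (phi n m)) : R) = 0 ->
    cls (@glue i X) (m, x) = cls (@glue i X) (n, y).
  move=> h; have h1 := mdist_ge0 x (dpt (phi m n)) : 0 <= _ :> R.
  have h2 := mdist_ge0 y (dpt (phi n m)) : 0 <= _ :> R.
  have /mdist_positivity -> : mdist x (dpt (phi m n)) = 0 :> R by lra.
  have /mdist_positivity -> : mdist y (dpt (phi n m)) = 0 :> R by lra.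
  exact: phi_cls.
move: mn K; move: X x y m n; case: (i) => Y x y m n /eqP/negbTE mn K.
  by rewrite /= /rho2 /= mn => h; apply: K; lra.
rewrite /= /rho3 /= mn; set k := third m n.
have [_ [_ [->|->]]] := minP
    (mdist x (dpt (phi m n : Di Tri)) + mdist y (dpt (phi n m : Di Tri)))
    (mdist x (dpt (phi m k : Di Tri)) + 1 + mdist y (dpt (phi n k : Di Tri))).
  by move=> h; apply: K; lra.
have := mdist_ge0 x (dpt (phi m k : Di Tri)) : 0 <= _ :> R.
have := mdist_ge0 y (dpt (phi n k : Di Tri)) : 0 <= _ :> R.
by clear K => h1 h2 h3; exfalso; lra.
Qed.

Let tensW (Q : tens X -> Prop) : (forall p, Q (cls (@glue i X) p)) -> forall xi, Q xi.
Proof. by move=> h xi; rewrite -(repK xi). Qed.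

Lemma tens_distxx (xi : tens X) : tens_dist xi xi = 0 :> R.
Proof. by move: xi; apply: tensW => p; rewrite tens_distE rho_xx. Qed.

Lemma tens_dist_eq0 (xi eta : tens X) : tens_dist xi eta = 0 :> R -> xi = eta.
Proof.
move: xi eta; apply: tensW => p; apply: tensW => q.
by rewrite tens_distE; exact: rho_eq0.
Qed.

Lemma tens_dist_sym (xi eta : tens X) : tens_dist xi eta = tens_dist eta xi :> R.
Proof.
move: xi eta; apply: tensW => p; apply: tensW => q.
by rewrite !tens_distE; exact: rho_sym.
Qed.

Lemma tens_dist_triangle (eta xi zeta : tens X) :
  tens_dist xi zeta <= tens_dist xi eta + tens_dist eta zeta :> R.
Proof.
move: eta xi zeta; apply: tensW => q; apply: tensW => p; apply: tensW => r.
by rewrite !tens_distE; exact: rho_triangle.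
Qed.

HB.instance Definition _ := isMetric.Build R (tens X)
  tens_distxx tens_dist_eq0 tens_dist_sym tens_dist_triangle.

Lemma tens_mdistE p q :
  mdist (p.1 ⊗ p.2 : tens X) (q.1 ⊗ q.2) = rho p q :> R.
Proof. by case: p q => [m x] [n y]; exact: tens_distE. Qed.

Lemma tens_mdist_le1 (xi eta : tens X) : mdist xi eta <= 1 :> R.
Proof.
have [m [x ->]] := tensP xi; have [n [y ->]] := tensP eta.
rewrite (tens_mdistE (m, x) (n, y)); exact: rho_le1.
Qed.

Lemma tens_mdist_dpt (d e : Di i) : d <> e ->
  mdist (dpt d : tens X) (dpt e : tens X) = 1 :> R.
Proof.
move=> de; rewrite !tens_dptE (tens_mdistE (own d, dpt d) (own e, dpt e)).
move: X d e de; case: (i) => Y d e de; rewrite /= /rho2 /rho3 /=.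
  rewrite M2E; case: d e de => -[] //= _; rewrite !dpt_dist /=;
  by do 2!case: eqP => //= _; lra.
rewrite M3E; case: d e de => -[] //= _; rewrite !dpt_dist /=;
  by do 4!case: eqP => //= _; rewrite /Num.min; case: ifP; lra.
Qed.

HB.instance Definition _ := isIPMetric.Build R i (tens X)
  tens_mdist_le1 tens_mdist_dpt.

End TensMetricInst.
Lemma rho_map (R : realType) (i : kind) (X Y : ipmetType R i) (f : ipt_hom X Y) m n x y :
  (forall x y, mdist (f x) (f y) = mdist x y :> R) ->
  rho (m, f x) (n, f y) = rho (m, x) (n, y) :> R.
Proof.
move: X Y f m n x y; case: (i) => X Y f m n x y h;
  by rewrite /= /rho2 /rho3 /= -!(hom_dpt f) !h.
Qed.

Lemma tmap_isom (R : realType) (i : kind) (X Y : ipmetType R i) (f : ipt_hom X Y) :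
  (forall x y, mdist (f x) (f y) = mdist x y :> R) ->
  forall x y, mdist (tmap f x) (tmap f y) = mdist x y :> R.
Proof.
move=> h x y; have [m [u ->]] := tensP x; have [n [v ->]] := tensP y.
rewrite !tmapE (tens_mdistE (m, f u) (n, f v)) (tens_mdistE (m, u) (n, v)).
exact: rho_map.
Qed.

Section Base.
Variables (R : realType) (i : kind).

Definition base : Type := Di i.
HB.instance Definition _ := Choice.on base.

Definition base_dist (d e : base) : R := (d != e)%:R.

Lemma base_distxx d : base_dist d d = 0.
Proof. by rewrite /base_dist eqxx. Qed.

Lemma base_dist_eq0 d e : base_dist d e = 0 -> d = e.
Proof. by rewrite /base_dist; case: eqP => //= _ /eqP; rewrite oner_eq0. Qed.

Lemma base_dist_sym d e : base_dist d e = base_dist e d.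
Proof. by rewrite /base_dist eq_sym. Qed.

Lemma base_dist_triangle e d f : base_dist d f <= base_dist d e + base_dist e f.
Proof.
rewrite /base_dist; have [->|de] := eqVneq d e; first by rewrite add0r.
by have [_|_] := eqVneq d f; have [_|_] := eqVneq e f; rewrite /= ?addr0 ?lexx//;
  rewrite ?lerDl //; lra.
Qed.

HB.instance Definition _ := isMetric.Build R base
  base_distxx base_dist_eq0 base_dist_sym base_dist_triangle.

HB.instance Definition _ :=
  hasDistinguished.Build i base (fun (d e : Di i) (h : d = e :> base) => h).

Lemma base_dist_le1 (d e : base) : mdist d e <= 1 :> R.
Proof. by rewrite /mdist /= /base_dist; case: (_ != _). Qed.

Lemma base_dist_dpt (d e : Di i) : d <> e ->
  mdist (dpt d : base) (dpt e : base) = 1 :> R.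
Proof. by move=> /eqP de; rewrite /mdist /= /base_dist de. Qed.

HB.instance Definition _ := isIPMetric.Build R i base base_dist_le1 base_dist_dpt.

End Base.

Section Colimit.
Variables (R : realType) (i : kind).

Fixpoint lev (n : nat) : ipmetType R i :=
  if n is k.+1 then tens (lev k) else base i.

Definition start : ipt_hom (lev 0) (lev 1) :=
  @IptHom i (lev 0) (lev 1) (fun d : Di i => dpt d) (fun d => erefl).

Fixpoint emb (n : nat) : ipt_hom (lev n) (lev n.+1) :=
  if n is k.+1 then tmap (emb k) else start.

Lemma start_isom x y : mdist (start x) (start y) = mdist x y :> R.
Proof.
rewrite /start /=; have [->|/eqP xy] := eqVneq x y; first by rewrite !mdistxx.
by rewrite mdist_dpt // -[x]/(dpt x : base i) -[y]/(dpt y : base i) mdist_dpt.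
Qed.

Lemma emb_isom n x y : mdist (emb n x) (emb n y) = mdist x y :> R.
Proof.
by elim: n x y => [|n IH] x y; [exact: start_isom|exact: (tmap_isom IH)].
Qed.

Definition stages : Type := {n : nat & lev n}.
HB.instance Definition _ := gen_eqMixin stages.
HB.instance Definition _ := gen_choiceMixin stages.

Definition stage (n : nat) (x : lev n) : stages := existT _ n x.

Inductive identify : stages -> stages -> Prop :=
| identify_emb n (x : lev n) : identify (stage x) (stage (emb n x)).

Definition Gi : Type := gen_quot identify.
HB.instance Definition _ := Choice.on Gi.

Definition inG (n : nat) (x : lev n) : Gi := cls identify (stage x).

(* The embeddings are isometric, so the set has exactly one element, which is
   the distance at any stage where both points are present: see [inG_dist]. *)
Definition G_dist (x y : Gi) : R :=
  inf [set r | exists n (u v : lev n), [/\ x = inG u, y = inG v & r = mdist u v]].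

Definition next_stage (s : stages) : stages := stage (emb (tag s) (tagged s)).

Lemma inG_emb n (x : lev n) : inG (emb n x) = inG x.
Proof. by apply/esym/clsP/rst_step; constructor. Qed.

Lemma inG_next s : cls identify (next_stage s) = cls identify s.
Proof. by case: s => n x; exact: inG_emb. Qed.

Lemma inG_iter k s : cls identify (iter k next_stage s) = cls identify s.
Proof. by elim: k => //= k IH; rewrite inG_next. Qed.

Lemma tag_iter k s : tag (iter k next_stage s) = (k + tag s)%N.
Proof. by elim: k => //= k ->; rewrite addSn. Qed.

Lemma identifyP s t : cls identify s = cls identify t ->
  exists k l, iter k next_stage s = iter l next_stage t.
Proof.
move/clsP; elim=> {s t} [_ _ [n x]|s|s t _ [k [l E]]|s t u _ [k [l E]] _ [k' [l' E']]].
- by exists 1%N, 0%N.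
- by exists 0%N, 0%N.
- by exists l, k.
- exists (k' + k)%N, (l + l')%N.
  by rewrite iterD E -iterD addnC iterD E' -iterD.
Qed.

Lemma stage_inj n (x y : lev n) : stage x = stage y -> x = y.
Proof. by move=> h; apply: (eq_from_Tagged h). Qed.

Lemma inG_common (x y : Gi) : exists n (u v : lev n), x = inG u /\ y = inG v.
Proof.
rewrite -(repK x) -(repK y); set s := rep x; set t := rep y.
rewrite -(inG_iter (tag s) t) -(inG_iter (tag t) s).
have := tag_iter (tag s) t; have := tag_iter (tag t) s.
move: (iter (tag t) _ _) (iter (tag s) _ _) => [n u] [m v] /= en em.
have nm : m = n by rewrite en em addnC.
by case: _ / nm u en => u _; exists m, u, v.
Qed.

Lemma iter_isom k n (x y : lev n) : exists u v : lev (k + n),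
  [/\ iter k next_stage (stage x) = stage u, iter k next_stage (stage y) = stage v
    & mdist u v = mdist x y :> R].
Proof.
elim: k => [|k [u [v [E1 E2 E3]]]]; first by exists x, y.
by exists (emb _ u), (emb _ v); rewrite /= E1 E2 emb_isom.
Qed.

Lemma stage_dist n (x y : lev n) m (u v : lev m) :
  stage x = stage u -> stage y = stage v -> mdist x y = mdist u v :> R.
Proof.
move=> E; have nm : n = m := congr1 (@projT1 _ _) E.
by case: _ / nm u v E => u v /stage_inj -> /stage_inj ->.
Qed.

Lemma inG_dist_eq n (x y : lev n) m (u v : lev m) :
  inG x = inG u -> inG y = inG v -> mdist x y = mdist u v :> R.
Proof.
move=> /identifyP[k [l E]] /identifyP[k' [l' E']].
have [x1 [y1 [X1 Y1 <-]]] := iter_isom (k' + k) x y.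
have [u1 [v1 [U1 V1 <-]]] := iter_isom (k' + l) u v.
have t1 : (k + n = l + m)%N by have := congr1 (fun s : stages => tag s) E; rewrite !tag_iter.
have t2 : (k' + n = l' + m)%N by have := congr1 (fun s : stages => tag s) E'; rewrite !tag_iter.
have e : (k' + l = k + l')%N.
  by apply/eqP; rewrite -(eqn_add2r m) -!addnA -t1 -t2 addnCA.
apply: stage_dist; first by rewrite -X1 -U1 !iterD E.
by rewrite -Y1 -V1 e addnC !iterD E'.
Qed.

Lemma inG_dist n (x y : lev n) : G_dist (inG x) (inG y) = mdist x y.
Proof.
rewrite /G_dist (_ : [set _ | _] = [set mdist x y : R]) ?inf1//.
apply/seteqP; split=> [r [m [u [v [h1 h2 ->]]]]|r ->] /=.
  by apply/esym/inG_dist_eq.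
by exists n, x, y.
Qed.

Lemma G_distxx x : G_dist x x = 0.
Proof. by have [n [u [_ [-> _]]]] := inG_common x x; rewrite inG_dist mdistxx. Qed.

Lemma G_dist_eq0 x y : G_dist x y = 0 -> x = y.
Proof.
have [n [u [v [-> ->]]]] := inG_common x y.
by rewrite inG_dist => /mdist_positivity ->.
Qed.

Lemma G_dist_sym x y : G_dist x y = G_dist y x.
Proof.
have [n [u [v [-> ->]]]] := inG_common x y.
by rewrite !inG_dist metric_sym.
Qed.

Lemma inG_iter_emb k n (u : lev n) : exists u' : lev (k + n), inG u = inG u'.
Proof.
by have [u' [_ [E _ _]]] := iter_isom k u u; exists u'; rewrite {1}/inG -(inG_iter k) E.
Qed.

Lemma G_dist_triangle y x z : G_dist x z <= G_dist x y + G_dist y z.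
Proof.
have [n [u [v [-> ->]]]] := inG_common x z.
have [m [w [_ [-> _]]]] := inG_common y y.
have [u' ->] := inG_iter_emb m u; have [v' ->] := inG_iter_emb m v.
have [w' ->] := inG_iter_emb n w; move: w'; rewrite addnC => w'.
by rewrite !inG_dist metric_triangle.
Qed.

HB.instance Definition _ := isMetric.Build R Gi
  G_distxx G_dist_eq0 G_dist_sym G_dist_triangle.

Lemma inG_mdist n (x y : lev n) : mdist (inG x) (inG y) = mdist x y :> R.
Proof. exact: inG_dist. Qed.

Lemma inG_dpt n d : inG (dpt d : lev n) = inG (dpt d : lev 0).
Proof. by elim: n => // n <-; rewrite -(hom_dpt (emb n)) inG_emb. Qed.

Lemma inG0_inj : injective (fun d : Di i => inG (dpt d : lev 0)).
Proof.
move=> d e h; apply: (@dpt_inj i (lev 0)); apply: (@mdist_positivity R).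
by rewrite -inG_mdist h mdistxx.
Qed.

HB.instance Definition _ := hasDistinguished.Build i Gi inG0_inj.

Lemma G_dist_le1 (x y : Gi) : mdist x y <= 1 :> R.
Proof.
have [n [u [v [-> ->]]]] := inG_common x y.
by rewrite inG_mdist mdist_le1.
Qed.

Lemma G_dist_dpt (d e : Di i) : d <> e -> mdist (dpt d : Gi) (dpt e : Gi) = 1 :> R.
Proof. by move=> de; rewrite inG_mdist; exact: mdist_dpt. Qed.

HB.instance Definition _ := isIPMetric.Build R i Gi G_dist_le1 G_dist_dpt.

Definition inG_hom n : ipt_hom (lev n) Gi := IptHom (@inG_dpt n).

Definition prefix_G (m : Mi i) (y : Gi) : Gi :=
  let s := rep y in inG (m ⊗ tagged s : lev (tag s).+1).

Lemma prefix_GE m n (x : lev n) : prefix_G m (inG x) = inG (m ⊗ x : lev n.+1).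
Proof.
have K s t : clos_refl_sym_trans _ identify s t ->
    inG (m ⊗ tagged s : lev (tag s).+1) = inG (m ⊗ tagged t : lev (tag t).+1).
  elim=> {s t} [_ _ [k u]|//|s t _ -> //|s t u _ -> _ ->//].
  by rewrite -(inG_emb (m ⊗ u : lev k.+1)) /= tmap_funE.
by apply: (K (rep (inG x)) (stage x)); apply/clsP; rewrite repK.
Qed.

Lemma inG_onto (y : Gi) : exists n (x : lev n), y = inG x.
Proof. by have [n [u [_ [-> _]]]] := inG_common y y; exists n, u. Qed.

Definition gmap_fun (xi : tens Gi) : Gi := prefix_G (rep xi).1 (rep xi).2.

Lemma gmap_prefix m y : gmap_fun (m ⊗ y) = prefix_G m y.
Proof.
have K p q : clos_refl_sym_trans _ (@glue i Gi) p q ->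
    prefix_G p.1 p.2 = prefix_G q.1 q.2.
  elim=> {p q} [p q|//|p q _ -> //|p q r _ -> _ ->//].
  move=> /(@glueP R i Gi)[k [l [kl -> ->]]] /=.
  rewrite !prefix_GE; congr (inG (_ : lev 1)).
  exact: (@phi_cls R i (lev 0)).
by apply: (K _ (m, y)); apply/clsP; rewrite repK.
Qed.

Lemma gmapE m n (x : lev n) : gmap_fun (m ⊗ inG x) = inG (m ⊗ x : lev n.+1).
Proof. by rewrite gmap_prefix prefix_GE. Qed.

Lemma gmap_dpt d : gmap_fun (dpt d) = dpt d.
Proof. by rewrite tens_dptE gmapE -[RHS](inG_dpt 1). Qed.

Definition gmap : ipt_hom (tens Gi) Gi := IptHom gmap_dpt.

Lemma gmap_isom xi eta : mdist (gmap xi) (gmap eta) = mdist xi eta :> R.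
Proof.
have [m [x ->]] := tensP xi; have [n [y ->]] := tensP eta.
have [k [u [v [-> ->]]]] := inG_common x y; rewrite /= !gmapE inG_mdist.
rewrite (tens_mdistE (m, u) (n, v)) (tens_mdistE (m, inG u) (n, inG v)).
by apply/esym/(@rho_map _ _ _ _ (inG_hom k)); exact: inG_mdist.
Qed.

Lemma gmap_inverse : exists h : Gi -> tens Gi, cancel gmap h /\ cancel h gmap.
Proof.
have inj : injective gmap.
  move=> x y h; apply: (@mdist_positivity R).
  by rewrite -gmap_isom h mdistxx.
have sur y : exists xi, gmap xi = y.
  have [n [x ->]] := inG_onto y; have [x1 ->] := inG_iter_emb 1 x.
  by have [m [u ->]] := tensP x1; exists (m ⊗ inG u); exact: gmapE.
pose h y := projT1 (cid (sur y)).
have hK : cancel h gmap by move=> y; exact: projT2 (cid (sur y)).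
by exists h; split=> // xi; apply: inj; rewrite hK.
Qed.

Definition ginv : Gi -> tens Gi := projT1 (cid gmap_inverse).

Lemma gmapK : cancel gmap ginv.
Proof. exact: (projT2 (cid gmap_inverse)).1. Qed.

Lemma ginvK : cancel ginv gmap.
Proof. exact: (projT2 (cid gmap_inverse)).2. Qed.

(* The element m_1 ⊗ (m_2 ⊗ ... (m_k ⊗ d)) of M^k ⊗ I, for
   [s = [:: m_1; ...; m_k]]. *)
Fixpoint word (s : seq (Mi i)) (d : Di i) : lev (size s) :=
  if s is m :: s' then m ⊗ word s' d else (d : base i).

End Colimit.
Section CauchyCriteria.
Variables (R : realType) (T : metricType R).

Lemma cauchy_seqP (u : nat -> T) : cauchy (u @ \oo) <->
  forall e : R, 0 < e -> exists N, forall m n, (N <= m)%N -> (N <= n)%N ->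
    mdist (u m) (u n) < e.
Proof.
split=> [/cauchy_ballP h e e0|h].
  have [[A B] [/= [N _ HN] [N' _ HN']] H] := h e e0.
  exists (maxn N N') => m n; rewrite !geq_max => /andP[Nm _] /andP[_ Nn].
  by have := H (u m, u n) (conj (HN m Nm) (HN' n Nn)); rewrite ballEmdist.
apply/cauchy_ballP => e /h[N H].
exists (u @` [set n | (N <= n)%N], u @` [set n | (N <= n)%N]) => /=.
  by split; exists N => // n Nn; exists n.
by move=> [_ _] /= [[m Nm <-] [n Nn <-]]; rewrite ballEmdist; exact: H.
Qed.

Lemma cvg_seqP (u : nat -> T) (x : T) : u n @[n --> \oo] --> x <->
  forall e : R, 0 < e -> exists N, forall n, (N <= n)%N -> mdist x (u n) < e.
Proof.
split=> [/metricType_numDomainType.cvgrPdist_lt h e /h[N _ H]|h].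
  by exists N => n; exact: H.
apply/metricType_numDomainType.cvgrPdist_lt => e /h[N H].
by exists N => // n; exact: H.
Qed.

End CauchyCriteria.

Lemma seq_cvg_le (R : realType) (a b : nat -> R) (la lb : R) N :
  a n @[n --> \oo] --> la -> b n @[n --> \oo] --> lb ->
  (forall n, (N <= n)%N -> a n <= b n) -> la <= lb.
Proof.
move=> ha hb h; have hb' : cvgn b by apply/cvg_ex; exists lb.
have ha' : cvgn a by apply/cvg_ex; exists la.
rewrite -(cvg_lim (@Rhausdorff R) ha) -(cvg_lim (@Rhausdorff R) hb).
by apply: ler_lim => //; exists N.
Qed.

Section Completion.
Variables (R : realType) (T : metricType R).

Record cauchy_seq := CauchySeq {
  cs_val :> nat -> T;
  cs_cauchy : cauchy (cs_val @ \oo)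
}.
HB.instance Definition _ := gen_eqMixin cauchy_seq.
HB.instance Definition _ := gen_choiceMixin cauchy_seq.

Implicit Types u v w : cauchy_seq.

Lemma mdist_diff (a b c d : T) :
  `|mdist a b - mdist c d| <= mdist a c + mdist b d :> R.
Proof.
have h1 := metric_triangle a c b; have h2 := metric_triangle c d b.
have h3 := metric_triangle c a d; have h4 := metric_triangle a b d.
rewrite (metric_sym d b) in h2; rewrite (metric_sym c a) in h3.
by rewrite ler_norml; lra.
Qed.

Lemma cs_dist_is_cvg u v : cvgn (fun n => mdist (u n) (v n) : R).
Proof.
apply/cauchy_cvgP/cauchy_ballP => e e0.
have e2 : 0 < e / 2 by rewrite divr_gt0.
have [N HN] := (cauchy_seqP u).1 (cs_cauchy u) _ e2.
have [N' HN'] := (cauchy_seqP v).1 (cs_cauchy v) _ e2.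
pose A := (fun n => mdist (u n) (v n) : R) @` [set n | (maxn N N' <= n)%N].
exists (A, A) => /=; first by split; exists (maxn N N') => // n Nn; exists n.
move=> [_ _] /= [[m Nm <-] [n Nn <-]]; rewrite /ball /= /ball_.
move: Nm Nn; rewrite /= !geq_max => /andP[Nm Nm'] /andP[Nn Nn'].
rewrite (le_lt_trans (mdist_diff _ _ _ _))// [ltRHS]splitr.
by rewrite ltrD ?HN ?HN'.
Qed.

Definition cs_dist u v : R := limn (fun n => mdist (u n) (v n) : R).

Lemma cs_dist_cvg u v : (mdist (u n) (v n) : R) @[n --> \oo] --> cs_dist u v.
Proof. exact: cs_dist_is_cvg. Qed.
Arguments cs_dist_cvg : clear implicits.

Lemma cs_distP u v (l : R) :
  (mdist (u n) (v n) : R) @[n --> \oo] --> l -> cs_dist u v = l.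
Proof. by move=> h; apply: cvg_lim. Qed.

Lemma cs_distxx u : cs_dist u u = 0.
Proof.
apply: cs_distP; rewrite (_ : (fun n => _) = cst 0); first exact: cvg_cst.
by apply/funext => n; exact: mdistxx.
Qed.

Lemma cs_dist_sym u v : cs_dist u v = cs_dist v u.
Proof.
apply: cs_distP; rewrite (_ : (fun n => _) = (fun n => mdist (v n) (u n))).
  exact: cs_dist_cvg.
by apply/funext => n; exact: metric_sym.
Qed.

Lemma cs_dist_triangle v u w : cs_dist u w <= cs_dist u v + cs_dist v w.
Proof.
have h : (mdist (u n) (v n) + mdist (v n) (w n) : R) @[n --> \oo] -->
    cs_dist u v + cs_dist v w by apply: cvgD; exact: cs_dist_cvg.
apply: (@seq_cvg_le R _ _ _ _ 0%N (cs_dist_cvg u w) h) => n _.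
exact: metric_triangle.
Qed.

Lemma cs_dist_ge0 u v : 0 <= cs_dist u v.
Proof.
have := cs_dist_triangle v u u; rewrite cs_distxx (cs_dist_sym v u); lra.
Qed.

Definition cs_equiv : rel cauchy_seq :=
  fun u v => `[< (mdist (u n) (v n) : R) @[n --> \oo] --> (0 : R) >].

Lemma cs_equivE u v : cs_equiv u v = (cs_dist u v == 0).
Proof.
apply/asboolP/eqP => [|<-]; last exact: cs_dist_cvg.
exact: cs_distP.
Qed.

Lemma cs_equiv_class : equiv_class_of cs_equiv.
Proof.
split.
- by move=> u; rewrite cs_equivE cs_distxx.
- by move=> u v; rewrite !cs_equivE cs_dist_sym.
- move=> v u w; rewrite !cs_equivE => /eqP h1 /eqP h2.
  by rewrite eq_le cs_dist_ge0 (le_trans (cs_dist_triangle v _ _))// h1 h2 addr0.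
Qed.

Canonical cs_equiv_rel := EquivRelPack cs_equiv_class.

Definition completion : Type := {eq_quot cs_equiv_rel}.
HB.instance Definition _ := Choice.on completion.

Definition cs_class (u : cauchy_seq) : completion := \pi_({eq_quot cs_equiv_rel}) u.
Definition cs_rep (x : completion) : cauchy_seq := repr (x : {eq_quot cs_equiv_rel}).

Lemma cs_repK : cancel cs_rep cs_class. Proof. exact: reprK. Qed.

Lemma cs_classP u v : cs_class u = cs_class v <-> cs_dist u v = 0.
Proof.
split=> [/(@eqquotP _ cs_equiv_rel) /= |h].
  by rewrite cs_equivE => /eqP.
by apply/(@eqquotP _ cs_equiv_rel); rewrite /= cs_equivE h.
Qed.

Definition completion_dist (x y : completion) : R := cs_dist (cs_rep x) (cs_rep y).

Lemma completion_distE u v : completion_dist (cs_class u) (cs_class v) = cs_dist u v.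
Proof.
have K w : cs_dist (cs_rep (cs_class w)) w = 0 by apply/cs_classP; rewrite cs_repK.
rewrite /completion_dist; move: (K u) (K v).
set u' := cs_rep (cs_class u); set v' := cs_rep (cs_class v) => h1 h2.
have := cs_dist_triangle u u' v'; have := cs_dist_triangle v u v'.
have := cs_dist_triangle u' u v; have := cs_dist_triangle v' u' v.
by rewrite (cs_dist_sym v v') (cs_dist_sym u u') h1 h2; lra.
Qed.

Let completionW (Q : completion -> Prop) : (forall u, Q (cs_class u)) -> forall x, Q x.
Proof. by move=> h x; rewrite -(cs_repK x). Qed.

Lemma completion_distxx x : completion_dist x x = 0.
Proof. exact: cs_distxx. Qed.

Lemma completion_dist_eq0 x y : completion_dist x y = 0 -> x = y.
Proof.
move: x y; apply: completionW => u; apply: completionW => v.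
by rewrite completion_distE => /cs_classP.
Qed.

Lemma completion_dist_sym x y : completion_dist x y = completion_dist y x.
Proof. exact: cs_dist_sym. Qed.

Lemma completion_dist_triangle y x z :
  completion_dist x z <= completion_dist x y + completion_dist y z.
Proof. exact: cs_dist_triangle. Qed.

HB.instance Definition _ := isMetric.Build R completion completion_distxx
  completion_dist_eq0 completion_dist_sym completion_dist_triangle.

Lemma completion_mdistE u v : mdist (cs_class u) (cs_class v) = cs_dist u v :> R.
Proof. exact: completion_distE. Qed.

Lemma const_cauchy (x : T) : cauchy ((fun=> x) @ \oo).
Proof. by apply/cauchy_seqP => e e0; exists 0%N => *; rewrite mdistxx. Qed.

Definition embed (x : T) : completion := cs_class (CauchySeq (const_cauchy x)).

Lemma embed_isom x y : mdist (embed x) (embed y) = mdist x y :> R.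
Proof.
rewrite completion_mdistE; apply: cs_distP.
exact: (@cvg_cst R (mdist x y) nat \oo _).
Qed.

Lemma embed_near u (e : R) : 0 < e ->
  exists N, forall n, (N <= n)%N -> mdist (cs_class u) (embed (u n)) < e.
Proof.
move=> e0; have e2 : 0 < e / 2 by rewrite divr_gt0.
have [N HN] := (cauchy_seqP u).1 (cs_cauchy u) _ e2.
exists N => n Nn; rewrite completion_mdistE (le_lt_trans (_ : _ <= e / 2))//; last by lra.
apply: (@seq_cvg_le R _ _ _ _ N (cs_dist_cvg _ _) (@cvg_cst R (e / 2) nat \oo _)) => m Nm.
by rewrite /= metric_sym ltW // HN.
Qed.

Lemma embed_cvg u : embed (u n) @[n --> \oo] --> cs_class u.
Proof. by apply/cvg_seqP => e; exact: embed_near. Qed.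

Lemma cs_dist_le u v (c : R) : (forall n, mdist (u n) (v n) <= c) -> cs_dist u v <= c.
Proof.
move=> h; by apply: (@seq_cvg_le R _ _ _ _ 0%N (cs_dist_cvg u v) (@cvg_cst R c nat \oo _)) => n _.
Qed.

Lemma completion_complete (x : nat -> completion) : cauchy (x @ \oo) ->
  exists y : completion, x n @[n --> \oo] --> y.
Proof.
move=> /cauchy_seqP hx.
have ap n : exists t : T, mdist (x n) (embed t) < n.+1%:R^-1 :> R.
  rewrite -(cs_repK (x n)); set u := cs_rep _.
  have e0 : 0 < n.+1%:R^-1 :> R by rewrite invr_gt0.
  have [N HN] := embed_near u e0.
  by exists (u N); exact: HN.
pose t n := projT1 (cid (ap n)).
have tP n : mdist (x n) (embed (t n)) < n.+1%:R^-1 :> R by exact: projT2 (cid (ap n)).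
have small (e : R) : 0 < e -> exists N, forall n, (N <= n)%N -> n.+1%:R^-1 < e.
  move=> e0; exists (Num.truncn e^-1) => n Nn.
  rewrite -[ltRHS]invrK ltf_pV2 ?posrE ?invr_gt0 ?ltr0n//.
  by rewrite (lt_le_trans (truncnS_gt _))// ler_nat.
have ct : cauchy (t @ \oo).
  apply/cauchy_seqP => e e0; have e3 : 0 < e / 3 by rewrite divr_gt0.
  have [N HN] := hx _ e3; have [N' HN'] := small _ e3.
  exists (maxn N N') => m n; rewrite !geq_max => /andP[Nm N'm] /andP[Nn N'n].
  rewrite -embed_isom.
  have h1 := metric_triangle (embed (t m)) (x m) (embed (t n)).
  have h2 := metric_triangle (x m) (x n) (embed (t n)).
  have h3 := HN m n Nm Nn; have h4 := HN' m N'm; have h5 := HN' n N'n.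
  have h6 := tP m; have h7 := tP n; rewrite metric_sym in h6.
  have h8 := lt_trans h6 h4; have h9 := lt_trans h7 h5.
  move: h1 h2 h3 h8 h9 => {h4 h5 h6 h7 tP HN HN' hx small}.
  move: (mdist _ _) (mdist _ _) (mdist _ _) (mdist _ _) (mdist _ _) => a b c d f; lra.
exists (cs_class (CauchySeq ct)); apply/cvg_seqP => e e0.
have e2 : 0 < e / 2 by rewrite divr_gt0.
have [N HN] := embed_near (CauchySeq ct) e2.
have [N' HN'] := small _ e2.
exists (maxn N N') => n; rewrite !geq_max => /andP[Nn N'n].
have h1 := HN n Nn; have h2 := HN' n N'n; have h3 := tP n.
have h4 := metric_triangle (cs_class (CauchySeq ct)) (embed (t n)) (x n).
rewrite metric_sym in h3; rewrite /= in h1.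
have h5 := lt_trans h3 h2; rewrite (le_lt_trans h4) // [ltRHS]splitr.
by rewrite ltrD.
Qed.

End Completion.

Section CompletionPoints.
Variables (R : realType) (i : kind) (T : ipmetType R i).

Lemma embed_dpt_inj : injective (fun d : Di i => embed (dpt d : T)).
Proof.
move=> d e h; apply: (@dpt_inj i T); apply: (@mdist_positivity R).
by rewrite -embed_isom h mdistxx.
Qed.

HB.instance Definition _ := hasDistinguished.Build i (completion T) embed_dpt_inj.

Lemma completion_dist_le1 (x y : completion T) : mdist x y <= 1 :> R.
Proof.
rewrite -(cs_repK x) -(cs_repK y) completion_mdistE; apply: cs_dist_le => n.
exact: mdist_le1.
Qed.

Lemma completion_dist_dpt (d e : Di i) : d <> e ->
  mdist (dpt d : completion T) (dpt e : completion T) = 1 :> R.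
Proof. by move=> de; rewrite embed_isom mdist_dpt. Qed.

HB.instance Definition _ := isIPMetric.Build R i (completion T)
  completion_dist_le1 completion_dist_dpt.

Definition embed_hom : ipt_hom T (completion T) :=
  @IptHom i T (completion T) (@embed R T) (fun d => erefl).

End CompletionPoints.

Lemma isom_continuous (R : realType) (U V : metricType R) (h : U -> V) :
  (forall s t, mdist (h s) (h t) = mdist s t :> R) -> continuous h.
Proof.
move=> hI s; apply/cvg_ballP => e e0; apply/nbhs_ballP; exists e => // t.
by rewrite !ballEmdist /= hI.
Qed.

Lemma completion_ext (R : realType) (T U : metricType R)
    (h k : completion T -> U) : continuous h -> continuous k ->
  (forall t, h (embed t) = k (embed t)) -> h = k.
Proof.
move=> hc kc hk; apply/funext => s; rewrite -(cs_repK s); set u := cs_rep s.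
have c1 : h (embed (u n)) @[n --> \oo] --> h (cs_class u).
  exact: (continuous_cvg _ (hc _) (@embed_cvg _ _ u)).
have c2 : k (embed (u n)) @[n --> \oo] --> k (cs_class u).
  exact: (continuous_cvg _ (kc _) (@embed_cvg _ _ u)).
apply: (cvg_unique (@metric_hausdorff R _) c1).
by rewrite (_ : (fun n => h _) = (fun n => k (embed (u n)))) //; apply/funext.
Qed.

Section FinalCoalgebra.
Variables (R : realType) (i : kind).

Definition Si : ipmetType R i := completion (Gi R i).

Definition inS : ipt_hom (Gi R i) Si := embed_hom (Gi R i).

Lemma prefix_dist m n (x y : Gi R i) :
  mdist (prefix_G m x) (prefix_G n y) = rho (m, x) (n, y) :> R.
Proof.
have E k z : prefix_G k z = gmap R i (k ⊗ z) by rewrite /= gmap_prefix.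
by rewrite !E gmap_isom (tens_mdistE (m, x) (n, y)).
Qed.

Lemma prefix_cauchy m (u : cauchy_seq (Gi R i)) :
  cauchy ((fun n => prefix_G m (u n)) @ \oo).
Proof.
apply/cauchy_seqP => e e0; have [N H] := (cauchy_seqP u).1 (cs_cauchy u) e e0.
exists N => k l Nk Nl; rewrite prefix_dist rho_diag.
have h := H k l Nk Nl; have := mdist_ge0 (u k) (u l) : 0 <= _ :> R; lra.
Qed.

Definition prefix_cs m u := CauchySeq (prefix_cauchy m u).

Lemma prefix_cs_dist m n u v : cs_dist (prefix_cs m u) (prefix_cs n v) =
  rho (m, cs_class u : Si) (n, cs_class v : Si).
Proof.
apply: cs_distP; apply/cvgrPdist_lt => e e0.
have [N H] := embed_near u e0; have [N' H'] := embed_near v e0.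
exists (maxn N N') => // k /=; rewrite geq_max => /andP[Nk Nk'].
rewrite prefix_dist -(@rho_map R i (Gi R i) Si inS); last exact: embed_isom.
rewrite -!tens_mdistE /=.
apply: le_lt_trans (mdist_diff _ _ _ _) _.
rewrite (tens_mdistE (m, cs_class u : Si) (m, embed (u k) : Si)).
rewrite (tens_mdistE (n, cs_class v : Si) (n, embed (v k) : Si)) !rho_diag.
by have := H k Nk; have := H' k Nk'; lra.
Qed.

Lemma letters_pigeonhole (c : nat -> Mi i) :
  exists m, forall N, exists k, (N <= k)%N /\ c k = m.
Proof.
apply: contrapT => /forallNP h.
have {}h m : exists N, forall k, (N <= k)%N -> c k <> m.
  have /existsNP[N /forallNP H] := h m; exists N => k Nk ck.
  by apply: (H k).
pose B m := projT1 (cid (h m)).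
have BP m k : (B m <= k)%N -> c k <> m by exact: (projT2 (cid (h m))).
have [K HK] : exists K, forall m, (B m <= K)%N.
  clearbody B; move: {c h BP} B; case: (i) => B.
    by exists (B Ml + B Mr)%N => -[]; rewrite ?leq_addr ?leq_addl.
  exists (B Ma + B Mb + B Mc)%N => -[]; rewrite ?leq_addl //.
    by rewrite -addnA leq_addr.
  by rewrite addnAC leq_addl.
exact: BP (HK (c K)) erefl.
Qed.

Lemma S_prefix (s : Si) : exists m u, s = cs_class (prefix_cs m u).
Proof.
rewrite -(cs_repK s); set w := cs_rep _.
pose xi n := ginv (w n).
have X n : exists p : Mi i * Gi R i, xi n = p.1 ⊗ p.2.
  by have [m [y ->]] := tensP (xi n); exists (m, y).
pose p n := projT1 (cid (X n)).
have pP n : xi n = (p n).1 ⊗ (p n).2 by exact: projT2 (cid (X n)).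
have [m Hm] := letters_pigeonhole (fun n => (p n).1).
pose phi N := projT1 (cid (Hm N)).
have phiP N : (N <= phi N)%N /\ (p (phi N)).1 = m by exact: projT2 (cid (Hm N)).
pose z N := (p (phi N)).2.
have zE N : w (phi N) = prefix_G m (z N).
  by rewrite -(ginvK (w _)) -/(xi _) pP (phiP N).2 /= gmap_prefix.
have cz : cauchy (z @ \oo).
  apply/cauchy_seqP => e e0; have e2 : 0 < e / 2 by rewrite divr_gt0.
  have [N H] := (cauchy_seqP w).1 (cs_cauchy w) _ e2.
  exists N => k l Nk Nl.
  have := H (phi k) (phi l) (leq_trans Nk (phiP k).1) (leq_trans Nl (phiP l).1).
  by rewrite !zE prefix_dist rho_diag; lra.
exists m, (CauchySeq cz); apply/cs_classP; apply: cs_distP.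
apply/cvgrPdist_lt => e e0.
have [N H] := (cauchy_seqP w).1 (cs_cauchy w) _ e0.
exists N => // k /= Nk; rewrite -zE sub0r normrN ger0_norm ?mdist_ge0//.
by apply: H => //; exact: leq_trans (phiP k).1.
Qed.

Lemma prefix_embed m y : inS (prefix_G m y) =
  cs_class (prefix_cs m (CauchySeq (const_cauchy y))).
Proof.
apply/cs_classP; apply: cs_distP => /=.
rewrite (_ : (fun _ => _) = fun=> 0); last by apply/funext => n; rewrite mdistxx.
exact: (@cvg_cst R 0 nat \oo _).
Qed.

Lemma psi_exists : exists h : Si -> tens Si,
  continuous h /\ forall y : Gi R i, h (inS y) = tmap inS (ginv y).
Proof.
have X (s : Si) : exists p : Mi i * cauchy_seq (Gi R i),
    s = cs_class (prefix_cs p.1 p.2).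
  by have [m [u ->]] := S_prefix s; exists (m, u).
pose p s := projT1 (cid (X s)).
have pP s : s = cs_class (prefix_cs (p s).1 (p s).2) by exact: projT2 (cid (X s)).
pose h s : tens Si := (p s).1 ⊗ (cs_class (p s).2 : Si).
have hE s m u : s = cs_class (prefix_cs m u) -> h s = m ⊗ (cs_class u : Si).
  move=> E; apply: (@mdist_positivity R).
  rewrite (tens_mdistE ((p s).1, cs_class (p s).2 : Si) (m, cs_class u : Si)).
  by rewrite -prefix_cs_dist -completion_mdistE -pP -E mdistxx.
have hI s t : mdist (h s) (h t) = mdist s t :> R.
  rewrite (tens_mdistE ((p s).1, cs_class (p s).2 : Si) ((p t).1, cs_class (p t).2 : Si)).
  by rewrite -prefix_cs_dist -completion_mdistE -!pP.
exists h; split; first exact: (isom_continuous hI).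
move=> y; rewrite -{1}(ginvK y); have [m [w ->]] := tensP (ginv y).
by rewrite tmapE /= gmap_prefix; apply: hE; exact: prefix_embed.
Qed.

Definition psi_fun : Si -> tens Si := projT1 (cid psi_exists).

Lemma psi_continuous : continuous psi_fun.
Proof. exact: (projT2 (cid psi_exists)).1. Qed.

Lemma psi_inS (y : Gi R i) : psi_fun (inS y) = tmap inS (ginv y).
Proof. exact: (projT2 (cid psi_exists)).2. Qed.

Lemma psi_unique (h : Si -> tens Si) : continuous h ->
  (forall y : Gi R i, h (inS y) = tmap inS (ginv y)) -> h = psi_fun.
Proof.
move=> hc hE.
have K y : h (inS y) = psi_fun (inS y) by rewrite hE psi_inS.
have Z := @completion_ext R (Gi R i) (tens Si) h psi_fun hc (@psi_continuous) K.
exact: Z.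
Qed.

Lemma psi_dpt d : psi_fun (dpt d) = dpt d.
Proof.
rewrite -(hom_dpt inS) psi_inS -(hom_dpt (gmap R i)) gmapK.
exact: hom_dpt.
Qed.

Definition psi : ipt_hom Si (tens Si) := IptHom psi_dpt.

End FinalCoalgebra.

Definition coalg_mor (i : kind) (X Y : iptType i) (e : ipt_hom X (tens X))
    (k : ipt_hom Y (tens Y)) (f : ipt_hom X Y) : Prop :=
  forall x, k (f x) = tmap f (e x).

(* The letters m_1, m_2, ... are [m 1], [m 2], ...; [m 0] is a dummy. *)
Definition iterates (i : kind) (X : iptType i) (e : ipt_hom X (tens X)) (x : X)
    (m : nat -> Mi i) (xs : nat -> X) : Prop :=
  xs 0%N = x /\ forall n, e (xs n) = m n.+1 ⊗ xs n.+1.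

Lemma iterates_exist (i : kind) (X : iptType i) (e : ipt_hom X (tens X)) (x : X) :
  exists m xs, iterates e x m xs.
Proof.
have H y : exists p : Mi i * X, e y = p.1 ⊗ p.2.
  by have [m [z ->]] := tensP (e y); exists (m, z).
pose p y := projT1 (cid (H y)).
have pP y : e y = (p y).1 ⊗ (p y).2 by exact: projT2 (cid (H y)).
pose xs n := iter n (fun y => (p y).2) x.
by exists (fun n => (p (xs n.-1)).1), xs; split=> // n; rewrite [LHS]pP.
Qed.

(* [theta R m n] is [m_1 ⊗ ... ⊗ m_n ⊗ bar m_n], for n >= 1. *)
Definition theta (R : realType) (i : kind) (m : nat -> Mi i) (n : nat) : Gi R i :=
  inG (word R [seq m k | k <- iota 1 n] (bar (m n))).

(* Main.v *)
Require Import Defs.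
From HB Require Import structures.
From mathcomp Require Import all_boot all_order all_algebra.
From mathcomp Require Import all_classical all_reals all_analysis.
From mathcomp Require Import lra.

Local Open Scope classical_set_scope.

(** Both halves of the statement rest on one fact: [psi] is an isometric
    bijection of [Si] onto [tens Si], and in [tens Si] two points of the same
    copy are at half their original distance.  So if the images of two points
    under [psi] carry the same first letter, the distance of the points is half
    that of their tails ([psi_half]).

    Existence of the mediating morphism is then Banach's fixed point argument.
    A mediating morphism is a fixed point of the map sending [f] to the
    composite of [e], [tmap f] and the inverse of [psi]; this map halves
    pointwise distances.  As all distances in [Si] are at most 1, the iterates
    of any pointed map are uniformly Cauchy, and their limit is the fixed point
    ([coalg_mor_exists]).  Working with [tmap f], which is defined on classes,
    makes any choice of representatives in [tens X] harmless.

    For the formula, let [f] be any mediating morphism.  The first letter of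
    [psi (f x)] may be taken to be [m 1], with tail [f (xs 1)]; the first letter
    of [theta] at [n.+1] is also [m 1], with tail the [n]-th term of the
    sequence of [xs 1].  Peeling off [n] letters bounds the distance from
    [f x] to [theta] at [n] by [2^-n] ([coalg_mor_theta_dist]), whatever
    the last entry of [theta] is.  Since every [x] has a sequence of iterates,
    this also shows that the mediating morphism is unique. *)

Set Implicit Arguments.
Unset Strict Implicit.
Unset Printing Implicit Defensive.

Import Order.TTheory GRing.Theory Num.Theory.
Import numFieldNormedType.Exports.

Local Open Scope ring_scope.

Lemma half_expn_small (R : realType) (e : R) : 0 < e ->
  exists N, forall n, (N <= n)%N -> 2^-1 ^+ n < e.
Proof.
move=> e0.
have /cvgrPdist_lt/(_ e e0)[N _ H] :
    (2^-1 : R) ^+ n @[n --> \oo] --> (0 : R).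
  by apply: cvg_expr; rewrite ger0_norm //; lra.
exists N => n /H /=.
by rewrite sub0r normrN ger0_norm // exprn_ge0.
Qed.

Lemma cvg_half_expn (R : realType) (T : metricType R) (u : nat -> T) (x : T) :
  (forall n, mdist x (u n) <= 2^-1 ^+ n :> R) -> u n @[n --> \oo] --> x.
Proof.
move=> h; apply/cvg_seqP => e /half_expn_small[N H].
by exists N => n /H; exact: le_lt_trans.
Qed.

Lemma seq_cvg_unique (R : realType) (T : metricType R) (u : nat -> T) (x y : T) :
  u n @[n --> \oo] --> x -> u n @[n --> \oo] --> y -> x = y.
Proof. by move=> ux uy; exact: (cvg_unique (@metric_hausdorff R _) ux uy). Qed.

Lemma ipt_hom_eq (i : kind) (X Y : iptType i) (f g : ipt_hom X Y) :
  f =1 g -> f = g.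
Proof.
case: f g => [f hf] [g hg] /= /funext fg; case: _ / fg hg => hg.
by congr IptHom; exact: Prop_irrelevance.
Qed.

Lemma ipt_hom_inhabited (i : kind) (X Y : iptType i) : inhabited (ipt_hom X Y).
Proof.
have d0 : Di i by case: (i); [exact: Top|exact: DT].
pose f (x : X) : Y :=
  if pselect (exists d : Di i, x = dpt d) is left h then dpt (projT1 (cid h))
  else dpt d0.
constructor; exists f => d; rewrite /f.
case: pselect => [h|[]]; last by exists d.
by case: cid => d' /= /dpt_inj <-.
Qed.

Section Psi.
Variables (R : realType) (i : kind).
Local Notation S := (Si R i).
Local Notation psi := (psi R i).

(** [psi] is given as a continuous extension, so this holds in the limit of
    points of [Gi R i], where it is the formula for the inverse of [gmap]. *)
Lemma psi_prefix m (u : cauchy_seq (Gi R i)) :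
  psi (cs_class (prefix_cs m u)) = m ⊗ (cs_class u : S).
Proof.
have c1 : psi (inS R i (prefix_G m (u n))) @[n --> \oo] -->
    psi (cs_class (prefix_cs m u)).
  exact: (continuous_cvg _ (@psi_continuous R i _)
            (@embed_cvg _ _ (prefix_cs m u))).
have c2 : psi (inS R i (prefix_G m (u n))) @[n --> \oo] -->
    m ⊗ (cs_class u : S).
  apply/cvg_seqP => e e0; have [N H] := embed_near u e0.
  exists N => n Nn; rewrite [psi _]psi_inS.
  have -> : prefix_G m (u n) = gmap R i (m ⊗ u n) by rewrite /= gmap_prefix.
  rewrite gmapK tmapE (tens_mdistE (m, cs_class u : S) (m, inS R i (u n))).
  rewrite rho_diag; have := H n Nn.
  have := mdist_ge0 (cs_class u) (embed (u n)) : 0 <= _ :> R.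
  by rewrite /=; lra.
exact: seq_cvg_unique c1 c2.
Qed.

Lemma psi_isom (s t : S) : mdist (psi s) (psi t) = mdist s t :> R.
Proof.
have [m [u ->]] := S_prefix s; have [n [v ->]] := S_prefix t.
rewrite !psi_prefix (tens_mdistE (m, cs_class u : S) (n, cs_class v : S)).
by rewrite -prefix_cs_dist completion_mdistE.
Qed.

Lemma psi_inj : injective psi.
Proof.
move=> s t E; apply: (@mdist_positivity R).
by rewrite -psi_isom E mdistxx.
Qed.

Lemma psi_onto (xi : tens S) : exists s, psi s = xi.
Proof.
have [m [s ->]] := tensP xi; exists (cs_class (prefix_cs m (cs_rep s))).
by rewrite psi_prefix cs_repK.
Qed.

(** The contraction behind everything below: a common first letter halves the
    distance of the tails. *)
Lemma psi_half m (s t s' t' : S) : psi s = m ⊗ s' -> psi t = m ⊗ t' ->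
  mdist s t = mdist s' t' / 2 :> R.
Proof.
move=> E F; rewrite -psi_isom E F (tens_mdistE (m, s') (m, t')).
exact: rho_diag.
Qed.

(** The dummy [m 0] makes this hold for [n = 0] too: after the shift it is
    the letter that decides the last entry. *)
Lemma thetaS (m : nat -> Mi i) n :
  theta R m n.+1 = prefix_G (m 1%N) (theta R (fun k => m k.+1) n).
Proof.
by rewrite /theta prefix_GE /= (iotaDl 1 1 n) -map_comp.
Qed.

Lemma psi_inS_prefix m y : psi (inS R i (prefix_G m y)) = m ⊗ inS R i y.
Proof.
have -> : prefix_G m y = gmap R i (m ⊗ y) by rewrite /= gmap_prefix.
by rewrite [psi _]psi_inS gmapK tmapE.
Qed.

End Psi.

Section Mediating.
Variables (R : realType) (i : kind) (X : iptType i) (e : ipt_hom X (tens X)).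
Local Notation S := (Si R i).
Local Notation psi := (psi R i).

(** As [psi] is onto, [tmap f] after [e] can be pulled back along [psi]; the
    result is pointed because [psi] is injective.  The mediating morphisms are
    the fixed points of this operation on pointed maps. *)
Lemma lift_exists (f : ipt_hom X S) :
  exists g : ipt_hom X S, forall x, psi (g x) = tmap f (e x).
Proof.
pose g x := projT1 (cid (psi_onto (tmap f (e x)))).
have gP x : psi (g x) = tmap f (e x) := projT2 (cid (psi_onto _)).
have gd d : g (dpt d) = dpt d by apply: psi_inj; rewrite gP !hom_dpt.
by exists (IptHom gd).
Qed.

Definition lift (f : ipt_hom X S) : ipt_hom X S := projT1 (cid (lift_exists f)).

Lemma liftE f x : psi (lift f x) = tmap f (e x).
Proof. exact: (projT2 (cid (lift_exists f))). Qed.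

Lemma lift_half f g x : exists y,
  mdist (lift f x) (lift g x) = mdist (f y) (g y) / 2 :> R.
Proof.
have [m [y E]] := tensP (e x); exists y.
by apply: (@psi_half _ _ m); rewrite liftE E tmapE.
Qed.

(** Distances are at most 1, which starts the induction for any [f]. *)
Lemma iter_lift_dist (f : ipt_hom X S) n k x :
  mdist (iter n lift f x) (iter (n + k) lift f x) <= 2^-1 ^+ n :> R.
Proof.
elim: n x => [|n IH] x; first exact: mdist_le1.
rewrite addSn /=; have [y ->] := lift_half (iter n lift f) (iter (n + k) lift f) x.
by have := IH y; rewrite exprS; lra.
Qed.

(** Banach's fixed point argument for [lift], carried out pointwise. *)
Lemma coalg_mor_exists : exists f : ipt_hom X S, coalg_mor e psi f.
Proof.
have [f0] := ipt_hom_inhabited X S.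
pose g n := iter n lift f0.
have gc x : cauchy ((fun n => g n x) @ \oo).
  apply/cauchy_seqP => r r0.
  have [N H] := half_expn_small (divr_gt0 r0 (ltr0Sn _ 1)).
  exists N => m n /subnKC <- /subnKC <-.
  have := metric_triangle (g (N + (m - N))%N x) (g N x) (g (N + (n - N))%N x).
  have := iter_lift_dist f0 N (m - N) x; have := iter_lift_dist f0 N (n - N) x.
  rewrite (metric_sym (g N x) (g (N + (m - N))%N x)); have := H N (leqnn N).
  rewrite -!/(g _); lra.
pose f x := projT1 (cid (completion_complete (gc x))).
have fP x : g n x @[n --> \oo] --> f x := projT2 (cid (completion_complete (gc x))).
have fd d : f (dpt d) = dpt d.
  apply: (@seq_cvg_unique R) (fP _) _; rewrite (_ : (fun n => g n _) = fun=> dpt d).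
    exact: (@cvg_cst S (dpt d) nat \oo _).
  by apply/funext => n; exact: hom_dpt.
exists (IptHom fd) => x /=.
suff -> : f x = lift (IptHom fd) x by exact: liftE.
have fS : g n.+1 x @[n --> \oo] --> f x.
  apply/cvg_seqP => r r0; have [N H] := (cvg_seqP _ _).1 (fP x) r r0.
  by exists N => n Nn; apply: H; exact: leqW.
apply: (@seq_cvg_unique R) fS _; apply/cvg_seqP => r r0.
have [m [y E]] := tensP (e x); have [N H] := (cvg_seqP _ _).1 (fP y) r r0.
exists N => n Nn.
rewrite (@psi_half R i m _ _ (f y) (g n y)) ?[g n.+1 x]/= ?liftE ?E ?tmapE //.
have := H n Nn; have := mdist_ge0 (f y) (g n y) : 0 <= _ :> R; lra.
Qed.

Lemma iteratesS x m xs : iterates e x m xs ->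
  iterates e (xs 1%N) (fun n => m n.+1) (fun n => xs n.+1).
Proof. by move=> [_ h]. Qed.

Lemma coalg_mor_theta_dist (f : ipt_hom X S) x m xs n :
  coalg_mor e psi f -> iterates e x m xs ->
  mdist (f x) (inS R i (theta R m n)) <= 2^-1 ^+ n :> R.
Proof.
move=> fP; elim: n x m xs => [|n IH] x m xs h; first exact: mdist_le1.
have Ex : psi (f x) = m 1%N ⊗ f (xs 1%N).
  by case: (h) => <- step; rewrite fP step tmapE.
rewrite thetaS (psi_half Ex (psi_inS_prefix _ _)).
by have := IH _ _ _ (iteratesS h); rewrite exprS; lra.
Qed.

Lemma coalg_mor_theta_cvg (f : ipt_hom X S) x m xs :
  coalg_mor e psi f -> iterates e x m xs ->
  inS R i (theta R m n) @[n --> \oo] --> f x.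
Proof.
by move=> fP h; apply: cvg_half_expn => n; exact: coalg_mor_theta_dist fP h.
Qed.

Lemma coalg_mor_unique (f g : ipt_hom X S) :
  coalg_mor e psi f -> coalg_mor e psi g -> f = g.
Proof.
move=> fP gP; apply: ipt_hom_eq => x; have [m [xs h]] := iterates_exist e x.
exact: seq_cvg_unique (coalg_mor_theta_cvg fP h) (coalg_mor_theta_cvg gP h).
Qed.

End Mediating.

Theorem proposition1 (R : realType) (i : kind) (X : iptType i)
    (e : ipt_hom X (tens X)) :
  exists f : ipt_hom X (Si R i),
    unique (coalg_mor e (psi R i)) f /\
    forall (x : X) (m : nat -> Mi i) (xs : nat -> X),
      iterates e x m xs -> inS R i (theta R m n) @[n --> \oo] --> f x.
Proof.
have [f fP] := @coalg_mor_exists R i X e.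
exists f; split; first by split=> // g; exact: coalg_mor_unique.
by move=> x m xs; exact: coalg_mor_theta_cvg.
Qed.
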